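(* Let $\mathcal C\subseteq(\mathbb C^2)^{\otimes n}$ be the codespace of an $[[n,k,d]]$ stabilizer code with $k\ge 1$, whose $n$ physical qubits are held by $n$ distinct leaf nodes, one qubit each. Let $T\subseteq\{1,\dots,n\}$ be a set of leaf nodes with $|T|\le d-1$, and let $\bar T$ be its complement. For a unit vector $|\psi_L\rangle\in\mathcal C$ put $$\rho_T=\operatorname{Tr}_{\bar T}\bigl(|\psi_L\rangle\langle\psi_L|\bigr).$$ Then $\rho_T$ is independent of the encoded logical state: for any two unit vectors $|\psi_L\rangle,|\varphi_L\rangle\in\mathcal C$, $$\operatorname{Tr}_{\bar T}\bigl(|\psi_L\rangle\langle\psi_L|\bigr)=\operatorname{Tr}_{\bar T}\bigl(|\varphi_L\rangle\langle\varphi_L|\bigr).$$ That is, any colluding subset of at most $d-1$ leaf nodes obtains no information about the logical input from its joint quantum shares.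
   Context: An $[[n,k]]$ stabilizer code is given by an abelian subgroup $S$ of the $n$-qubit Pauli group with $-I\notin S$, generated by $n-k$ independent elements; its codespace is $\mathcal C=\{|\psi\rangle : s|\psi\rangle=|\psi\rangle\ \forall s\in S\}$, of dimension $2^k$. Its distance $d$ is the minimum weight (number of non-identity tensor factors) of a Pauli operator that commutes with all elements of $S$ but is not, up to a phase, an element of $S$. An $[[n,k,d]]$ code is an $[[n,k]]$ code of distance $d$. *)

(* Defs.v *)
From HB Require Import structures.
From mathcomp Require Import all_boot all_order all_fingroup all_algebra.

Set Implicit Arguments.
Unset Strict Implicit.
Unset Printing Implicit Defensive.

Import GroupScope GRing.Theory Num.Theory.
Local Open Scope ring_scope.
Local Open Scope sesquilinear_scope.

(* Registers of qubits. The qubits of a register are the elements of a finite *)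
(* type I and its computational basis is the set of functions I -> {0,1}, so  *)
(* (C^2)^{(x) I} is the space of column vectors of size #|bits I|, with       *)
(* coordinates listed in the order of the enumeration of bits I.              *)

Notation bits I := {ffun I -> 'I_2}.

Notation "''ket[' C ]_ I" := 'cV[C]_(#|bits I|)
  (at level 8, I at level 2, format "''ket[' C ]_ I").
Notation "''op[' C ]_ I" := 'M[C]_(#|bits I|)
  (at level 8, I at level 2, format "''op[' C ]_ I").

Section Registers.
Variables (C : numClosedFieldType) (I : finType).
Implicit Types (psi : 'ket[C]_I) (A : 'op[C]_I) (T : {set I}).

Definition unit_vector psi : Prop := psi ^t* *m psi = 1%:M.

Definition proj_op psi : 'op[C]_I := psi *m psi ^t*.

Definition tensor_op (F : I -> 'M[C]_2) : 'op[C]_I :=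
  \matrix_(i, j) \prod_(q : I) F q ((enum_val i : bits I) q) ((enum_val j : bits I) q).

Definition qubits_in T : finType := {q : I | q \in T}.

Definition restrict T (x : bits I) : bits (qubits_in T) :=
  [ffun q => x (val q)].

(* Writing x = (x_T, x_{~T}), the trace over the qubits outside T is the      *)
(* linear map sending |x><y| to |x_T><y_T| if x_{~T} = y_{~T}, and to 0       *)
(* otherwise; hence <a| Tr_{~T}(A) |b> is the sum of all <x|A|y> such that    *)
(* x_T = a, y_T = b and x_{~T} = y_{~T}.                                      *)
Definition trace_out_compl T A : 'op[C]_(qubits_in T) :=
  \matrix_(a, b)
    \sum_(x : bits I | restrict T x == enum_val a)
      \sum_(y : bits I | (restrict T y == enum_val b)
                         && (restrict (~: T) x == restrict (~: T) y))
        A (enum_rank x) (enum_rank y).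

End Registers.

Inductive pauli1 := PI | PX | PY | PZ.

Definition pauli1_code (p : pauli1) : bool * bool :=
  match p with
  | PI => (false, false) | PX => (true, false)
  | PY => (true, true) | PZ => (false, true)
  end.
Definition pauli1_decode (b : bool * bool) : pauli1 :=
  match b with
  | (false, false) => PI | (true, false) => PX
  | (true, true) => PY | (false, true) => PZ
  end.
Lemma pauli1_codeK : cancel pauli1_code pauli1_decode.
Proof. by case. Qed.
HB.instance Definition _ := Finite.copy pauli1 (can_type pauli1_codeK).

Definition pauli1_mul (p q : pauli1) : pauli1 :=
  match p, q with
  | PI, r | r, PI => r
  | PX, PX | PY, PY | PZ, PZ => PI
  | PX, PY | PY, PX => PZ
  | PY, PZ | PZ, PY => PX
  | PZ, PX | PX, PZ => PY
  end.

(* The exponent e such that the matrices satisfy p q = i^e (pauli1_mul p q).  *)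
Definition pauli1_phase (p q : pauli1) : 'Z_4 :=
  match p, q with
  | PX, PY | PY, PZ | PZ, PX => 1
  | PY, PX | PZ, PY | PX, PZ => -1
  | _, _ => 0
  end.

(* Pauli c p stands for the operator i^c p_0 (x) ... (x) p_{n-1}: see pauli_op *)
(* below, shown to be an injective group morphism by pauli_opM, pauli_op_inj.  *)

Record pauli (n : nat) := Pauli {
  pauli_phase : 'Z_4;
  pauli_string : {ffun 'I_n -> pauli1}
}.

Section PauliGroup.
Variable n : nat.
Implicit Types p q : pauli n.

Definition pauli_pair p := (pauli_phase p, pauli_string p).
Definition pair_pauli (u : 'Z_4 * {ffun 'I_n -> pauli1}) := Pauli u.1 u.2.
Lemma pauli_pairK : cancel pauli_pair pair_pauli.
Proof. by case. Qed.
HB.instance Definition _ := Finite.copy (pauli n) (can_type pauli_pairK).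

Definition pauli_mul p q : pauli n :=
  Pauli (pauli_phase p + pauli_phase q
         + \sum_(i < n) pauli1_phase (pauli_string p i) (pauli_string q i))
        [ffun i => pauli1_mul (pauli_string p i) (pauli_string q i)].

Definition pauli_one : pauli n := Pauli 0 [ffun => PI].

(* Pauli strings square to the identity. *)
Definition pauli_inv p : pauli n := Pauli (- pauli_phase p) (pauli_string p).

Lemma pauli_mulA : associative pauli_mul.
Proof.
move=> [a p] [b q] [c r]; rewrite /pauli_mul /=; congr Pauli; last first.
  by apply/ffunP=> i; rewrite !ffunE; case: (p i) (q i) (r i) => [] [] [].
rewrite !addrA [in RHS](addrAC (a + b)) -!(addrA (a + b + c)) -!big_split /=.
congr (_ + _); apply: eq_bigr => i _.
by rewrite !ffunE; case: (p i) (q i) (r i) => [] [] []; apply/eqP.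
Qed.

Lemma pauli_mul1 : left_id pauli_one pauli_mul.
Proof.
case=> a p; rewrite /pauli_mul /=; congr Pauli; last first.
  by apply/ffunP=> i; rewrite !ffunE.
by rewrite add0r big1 ?addr0 // => i _; rewrite ffunE.
Qed.

Lemma pauli_mulV : left_inverse pauli_one pauli_inv pauli_mul.
Proof.
case=> a p; rewrite /pauli_mul /pauli_one /=; congr Pauli; last first.
  by apply/ffunP=> i; rewrite !ffunE; case: (p i).
by rewrite addNr add0r big1 // => i _; case: (p i).
Qed.

HB.instance Definition _ :=
  Finite_isGroup.Build (pauli n) pauli_mulA pauli_mul1 pauli_mulV.

Definition scalar_pauli (c : 'Z_4) : pauli n := Pauli c [ffun => PI].

Definition weight p : nat := #|[set i | pauli_string p i != PI]|.

End PauliGroup.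

Section PauliOperators.
Variable C : numClosedFieldType.

Definition mx22 (a b c d : C) : 'M[C]_2 :=
  \matrix_(i, j) if i == 0 then (if j == 0 then a else b)
                 else (if j == 0 then c else d).

Definition pauli1_mx (p : pauli1) : 'M[C]_2 :=
  match p with
  | PI => mx22 1 0 0 1
  | PX => mx22 0 1 1 0
  | PY => mx22 0 (- 'i) 'i 0
  | PZ => mx22 1 0 0 (-1)
  end.

Definition pauli_op n (p : pauli n) : 'op[C]_'I_n :=
  'i ^+ pauli_phase p *: tensor_op (fun i => pauli1_mx (pauli_string p i)).

Lemma tensor_opM (I : finType) (F G : I -> 'M[C]_2) :
  tensor_op F *m tensor_op G = tensor_op (fun q => F q *m G q).
Proof.
apply/matrixP=> i j; rewrite !mxE.
under [RHS]eq_bigr do rewrite mxE.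
rewrite bigA_distr_bigA /= (reindex (fun x : bits I => enum_rank x)) /=.
  by apply: eq_bigr => x _; rewrite !mxE -big_split /= enum_rankK.
by exists enum_val => x _; rewrite ?enum_valK ?enum_rankK.
Qed.

Lemma exprIZ4D (a b : 'Z_4) : 'i ^+ (a + b)%R = 'i ^+ a * 'i ^+ b :> C.
Proof.
have I4 : 'i ^+ 4 = 1 :> C by rewrite (exprM _ 2 2) sqrCi sqrrN expr1n.
by rewrite -exprD -(expr_mod (a + b)%N I4).
Qed.

Lemma pauli1_mxM p q :
  pauli1_mx p *m pauli1_mx q =
  'i ^+ pauli1_phase p q *: pauli1_mx (pauli1_mul p q).
Proof.
have I2 : 'i * 'i = -1 :> C by rewrite -expr2 sqrCi.
have I3 : 'i ^+ 3 = - 'i :> C by rewrite exprS sqrCi mulrN1.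
by case: p q => [] []; apply/matrixP=> i j;
  rewrite !mxE !big_ord_recl big_ord0 !mxE /= ?expr0 ?expr1 ?I3;
  case: (i == 0); case: (j == 0);
  rewrite ?(mulr0, mul0r, mulr1, mul1r, addr0, add0r, mulrN, mulNr, I2, opprK,
            oppr0).
Qed.

Lemma pauli_opM n (p q : pauli n) :
  pauli_op (p * q)%g = pauli_op p *m pauli_op q.
Proof.
rewrite /pauli_op -scalemxAl -scalemxAr scalerA tensor_opM.
rewrite !exprIZ4D -[RHS]scalerA -!scalerA; congr (_ *: (_ *: _)).
apply/matrixP=> i j; rewrite !mxE.
have -> : 'i ^+ (\sum_(k < n) pauli1_phase (pauli_string p k)
                                           (pauli_string q k))%R
          = \prod_(k < n) 'i ^+ pauli1_phase (pauli_string p k)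
                                             (pauli_string q k) :> C.
  by apply: (big_morph (fun a : 'Z_4 => 'i ^+ a : C) exprIZ4D).
by rewrite -big_split; apply: eq_bigr => k _; rewrite pauli1_mxM !mxE ffunE.
Qed.

Lemma pauli_op_eq1 n (p : pauli n) : pauli_op p = 1%:M -> p = 1%g.
Proof.
case: p => c s /matrixP op1; rewrite /pauli_op /= in op1.
have diag (x : bits 'I_n) : 'i ^+ c * \prod_i pauli1_mx (s i) (x i) (x i) = 1.
  by have := op1 (enum_rank x) (enum_rank x); rewrite !mxE eqxx enum_rankK.
have s_diag i : (s i == PI) || (s i == PZ).
  have : \prod_(j < n) pauli1_mx (s j) 0 0 != 0.
    apply: contra_eq_neq (diag [ffun=> 0]) => s0.
    under eq_bigr do rewrite ffunE.
    by rewrite s0 mulr0 eq_sym oner_eq0.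
  by move/prodf_neq0/(_ i isT); case: (s i); rewrite ?mxE ?eqxx.
have s00 i : pauli1_mx (s i) 0 0 = 1.
  by have := s_diag i; case: (s i) => //; rewrite mxE.
have ic1 : 'i ^+ c = 1 :> C.
  by have := diag [ffun=> 0]; rewrite big1 ?mulr1 // => i _; rewrite ffunE.
have N1 : -1 != 1 :> C.
  by rewrite -subr_eq0 -opprD oppr_eq0 -(natrD _ 1 1) pnatr_eq0.
congr Pauli.
  have : 'i ^+ c ^+ 2 = 1 :> C by rewrite ic1 expr1n.
  rewrite -exprM mulnC exprM sqrCi; case: c {op1 diag} ic1.
  case=> [|[|[|[|//]]]] lt_c /= ic1 => [_|/eqP|_|/eqP]; first exact: val_inj.
  - by rewrite expr1 (negPf N1).
  - by move/eqP: ic1; rewrite sqrCi (negPf N1).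
  - by rewrite -signr_odd expr1 (negPf N1).
apply/ffunP=> i; rewrite ffunE.
have := diag [ffun j => if j == i then 1 else 0].
rewrite ic1 mul1r (bigD1 i) //= big1 => [|j /negPf ji]; last by rewrite ffunE ji.
rewrite mulr1 ffunE eqxx; have := s_diag i; case: (s i) => // _.
by rewrite mxE /= => /eqP; rewrite (negPf N1).
Qed.

Lemma pauli_op_inj n : injective (@pauli_op n).
Proof.
have op1 : pauli_op (1 : pauli n)%g = 1%:M.
  apply/matrixP=> i j; rewrite /pauli_op !mxE /= expr0 mul1r.
  have [->|ne_ij] := eqVneq i j.
    by rewrite big1 // => q _; rewrite ffunE mxE; case: (_ == 0).
  have [q ne_q] : exists q, (enum_val i : bits _) q != (enum_val j : bits _) q.
    apply/existsP; apply: contra_neqT ne_ij => /existsPn eq_ij.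
    by apply/enum_val_inj/ffunP=> q; apply/eqP/negPn/eq_ij.
  rewrite (bigD1 q) //= ffunE mxE [X in X * _](_ : _ = 0) ?mul0r //.
  by move: ne_q; do 2!case: (_ q) => [[|[|//]] ?].
move=> p q eq_pq; apply/eqP; rewrite -(can_eq (mulgK q^-1)%g) mulgV; apply/eqP.
by apply: pauli_op_eq1; rewrite pauli_opM eq_pq -pauli_opM mulgV op1.
Qed.

End PauliOperators.

Section StabilizerCodes.
Variable n : nat.
Implicit Type S : {group pauli n}.

Definition independent r (g : 'I_r -> pauli n) : Prop :=
  forall i, g i \notin <<[set g j | j in [set~ i]]>>.

Definition stabilizer_code (k : nat) S : Prop :=
  [/\ (k <= n)%N,
      abelian S,
      scalar_pauli n 2 \notin S (* i^2 I = - I *)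
    & exists g : 'I_(n - k) -> pauli n,
        independent g /\ S :=: <<[set g i | i in 'I_(n - k)]>>].

Definition codespace (C : numClosedFieldType) S (psi : 'ket[C]_'I_n) : Prop :=
  forall s, s \in S -> pauli_op C s *m psi = psi.

(* Operators commuting with S that are not in S up to a phase. *)
Definition nontrivial_logical S : {set pauli n} :=
  [set p in 'C(S) | [forall c, scalar_pauli n c * p \notin S]%g].

Definition code_distance S (d : nat) : Prop :=
  (exists2 p, p \in nontrivial_logical S & weight p = d)
  /\ (forall p, p \in nontrivial_logical S -> (d <= weight p)%N).

Definition stabilizer_code_dist (k d : nat) S : Prop :=
  stabilizer_code k S /\ code_distance S d.

End StabilizerCodes.

(* Main.v *)
Require Import Defs.
From mathcomp Require Import all_boot all_order all_fingroup all_algebra.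
From mathcomp Require Import reals complex ring.

(* The matrix units on the qubits of T span the operators on T, and so do the *)
(* Pauli strings supported on T; hence Tr_{~T}(A) is determined by the traces *)
(* tr(P A) for these strings P. Let |psi> be a code state and A = |psi><psi|. *)
(* - If P s = z s P for some s in S and z <> 1, then                          *)
(*   tr(P A) = tr(P s A) = z tr(s P A) = z tr(P A s) = z tr(P A), hence 0.    *)
(* - If P commutes with S, its weight being smaller than d, i^c P is in S for *)
(*   some c, so P acts on the code as i^-c and tr(P A) = i^-c.                *)
(* In both cases tr(P A) does not depend on psi.                              *)

Set Implicit Arguments.
Unset Strict Implicit.
Unset Printing Implicit Defensive.

Import GroupScope GRing.Theory Num.Theory.
Local Open Scope ring_scope.
Local Open Scope sesquilinear_scope.

(** A reduced state is fixed by its expectation values, and only Paulis too light to act as logical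
    operators are measurable on [T]. By [trace_out_complE] each entry of the reduced matrix is the
    trace of the projector against a matrix unit on [T] tensored with the identity.
    [tensor_op_pauli_expansion] expands that operator in Pauli strings on all [n] qubits; strings
    leaving [T] get coefficient zero. The others have weight below [d], so [expectation_indep]
    applies to each. *)

Section PauliExpansion.
Variable C : numClosedFieldType.

Lemma big_pauli1 (V : nmodType) (f : pauli1 -> V) :
  \sum_p f p = f PI + f PX + f PY + f PZ.
Proof.
have uP : perm_eq (enum {: pauli1}) [:: PI; PX; PY; PZ].
  apply: uniq_perm; rewrite ?enum_uniq // => p.
  by rewrite mem_enum; case: p.
by rewrite -big_enum (perm_big _ uP) !big_cons big_nil /= addr0 !addrA.
Qed.

(** The Hilbert-Schmidt coefficient: Pauli matrices are Hermitian and pairwise orthogonal, with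
    squared norm 2. *)
Definition pauli1_coef (M : 'M[C]_2) (p : pauli1) : C :=
  \tr (pauli1_mx C p *m M) / 2%:R.

Lemma pauli1_expansion (M : 'M[C]_2) :
  M = \sum_p pauli1_coef M p *: pauli1_mx C p.
Proof.
have I2 : 'i * 'i = -1 :> C by rewrite -expr2 sqrCi.
rewrite big_pauli1 /pauli1_coef /mxtrace.
apply/matrixP=> i j; rewrite !(big_ord_recl, big_ord0, mxE) /=.
have [-> | ->] : i = ord0 \/ i = lift ord0 ord0.
  by case: i => [[|[|//]] ?]; [left|right]; apply: val_inj.
all: have [-> | ->] : j = ord0 \/ j = lift ord0 ord0;
  first by case: j => [[|[|//]] ?]; [left|right]; apply: val_inj.
all: rewrite /=; move: (M _ _) (M _ _) (M _ _) (M _ _) => a b c e.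
all: by field: I2.
Qed.

Lemma pauli1_coef1 p : p != PI -> pauli1_coef 1%:M p = 0.
Proof.
rewrite /pauli1_coef mulmx1 /mxtrace !big_ord_recl big_ord0.
by case: p => //= _; rewrite !mxE /= ?(addr0, add0r, subrr, mul0r).
Qed.

(** Multilinearity: choosing one summand per qubit amounts to choosing a Pauli string. *)
Lemma tensor_op_pauli_expansion (I : finType) (F : I -> 'M[C]_2) :
  tensor_op F = \sum_(s : {ffun I -> pauli1})
    (\prod_q pauli1_coef (F q) (s q)) *: tensor_op (fun q => pauli1_mx C (s q)).
Proof.
apply/matrixP=> i j; rewrite summxE !mxE.
under eq_bigr => q _ do rewrite [F q]pauli1_expansion summxE.
rewrite bigA_distr_bigA; apply: eq_bigr => s _.
by rewrite !mxE -big_split; apply: eq_bigr => q _; rewrite mxE.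
Qed.

Lemma tensor_op1 (I : finType) : tensor_op (fun=> 1%:M) = 1%:M :> 'op[C]_I.
Proof.
apply/matrixP=> i j; rewrite !mxE.
have [->|] := eqVneq i j; first by rewrite big1 // => q _; rewrite mxE eqxx.
apply: contra_neq_eq => /prodf_neq0 nz.
apply/enum_val_inj/ffunP=> q; move: (nz q isT); rewrite mxE.
by apply: contraNeq => /negPf->.
Qed.

Lemma tensor_op_adj (I : finType) (F : I -> 'M[C]_2) :
  (tensor_op F) ^t* = tensor_op (fun q => (F q) ^t*).
Proof.
apply/matrixP=> i j; rewrite !mxE rmorph_prod.
by apply: eq_bigr => q _; rewrite !mxE.
Qed.

End PauliExpansion.

Section PartialTrace.
Variables (C : numClosedFieldType) (I : finType) (T : {set I}).

(* The tensor factors of |a><b| (x) 1, with |a><b| acting on the qubits of T. *)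
Definition local_unit (a b : bits (qubits_in T)) (q : I) : 'M[C]_2 :=
  if insub q is Some r then delta_mx (a r) (b r) else 1%:M.

Lemma local_unitE (a b : bits (qubits_in T)) (x y : bits I) :
  \prod_q local_unit a b q (x q) (y q) =
  [&& Defs.restrict T x == a, Defs.restrict T y == b
    & Defs.restrict (~: T) x == Defs.restrict (~: T) y]%:R.
Proof.
case: and3P => [[/eqP xa /eqP yb /eqP xy]|ne].
  apply: big1 => q _; rewrite /local_unit; case: insubP => [r qT rq|qT].
    by rewrite mxE -xa -yb !ffunE rq !eqxx.
  have qTC : q \in ~: T by rewrite inE.
  by move/ffunP/(_ (exist _ q qTC)): xy; rewrite !ffunE mxE /= => ->;
    rewrite eqxx.
apply/eqP/prodf_eq0/exists_inP; apply: contra_notT ne => /exists_inPn nz.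
split; apply/eqP/ffunP=> -[q qT]; rewrite !ffunE /=;
  have := nz q isT; rewrite /local_unit.
- by rewrite (insubT (mem T) qT) mxE; apply: contraNeq => /negPf->.
- by rewrite (insubT (mem T) qT) mxE andbC; apply: contraNeq => /negPf->.
- rewrite insubF ?mxE; last by move: qT; rewrite inE => /negPf.
  by apply: contraNeq => /negPf->.
Qed.

(** Duality of partial trace and tensoring with the identity. The indices swap because the entry at
    a, b is the trace against |b><a|. *)
Lemma trace_out_complE (A : 'op[C]_I) i j :
  trace_out_compl T A i j =
  \tr (tensor_op (local_unit (enum_val j) (enum_val i)) *m A).
Proof.
rewrite mxE /mxtrace (reindex (@enum_rank _)) /=; last first.
  by exists enum_val => x _; rewrite ?enum_valK ?enum_rankK.
under [RHS]eq_bigr => y _.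
  rewrite mxE (reindex (@enum_rank _)) /=; last first.
    by exists enum_val => x _; rewrite ?enum_valK ?enum_rankK.
  under eq_bigr => x _ do rewrite mxE !enum_rankK local_unitE.
  over.
rewrite exchange_big [LHS]big_mkcond; apply: eq_bigr => x _ /=.
rewrite [X in if _ then X else _]big_mkcond /=.
case: ifP => _; last by rewrite big1 // => y _; rewrite andbF mul0r.
apply: eq_bigr => y _; rewrite [_ == Defs.restrict _ y]eq_sym.
by case: ifP => _; rewrite ?mul1r ?mul0r.
Qed.

End PartialTrace.

Section PauliGroupFacts.
Variables (C : numClosedFieldType) (n : nat).
Implicit Types p q s : pauli n.

Lemma pauli_op_phase p q : pauli_string p = pauli_string q ->
  pauli_op C p = 'i ^+ (pauli_phase p - pauli_phase q)%R *: pauli_op C q.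
Proof. by move=> pq; rewrite /pauli_op scalerA -exprIZ4D subrK pq. Qed.

(** Noncommutativity lives in the phase alone, so by [pauli_op_phase] two Paulis commute up to a
    power of ['i]. *)
Lemma pauli_stringC p q : pauli_string (p * q)%g = pauli_string (q * p)%g.
Proof. by apply/ffunP=> i; rewrite !ffunE; do 2!case: (pauli_string _ i). Qed.

Lemma pauli_op_unitary p : (pauli_op C p) ^t* *m pauli_op C p = 1%:M.
Proof.
have pauli1_unitary (r : pauli1) : (pauli1_mx C r) ^t* *m pauli1_mx C r = 1%:M.
  have -> : (pauli1_mx C r) ^t* = pauli1_mx C r.
    apply/matrixP=> i j; rewrite !mxE; case: r; rewrite !mxE;
      case: (i == 0); case: (j == 0) => /=;
      by rewrite ?(rmorph0, rmorph1, rmorphN1, rmorphN) /= ?conjCi ?opprK.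
  rewrite pauli1_mxM; case: r; rewrite scale1r; apply/matrixP=> i j;
    by rewrite !mxE; case: i => [[|[|//]] ?]; case: j => [[|[|//]] ?].
rewrite /pauli_op -scalemxAr [in _ ^T]linearZ /= map_mxZ -scalemxAl scalerA.
rewrite tensor_op_adj tensor_opM rmorphXn /= conjCi -exprMn mulrN -expr2 sqrCi.
rewrite opprK expr1n scale1r -tensor_op1; apply/matrixP=> i j; rewrite !mxE.
by apply: eq_bigr => q _; rewrite pauli1_unitary.
Qed.

Lemma weight_eq0 p : weight p = 0%N -> p = scalar_pauli n (pauli_phase p).
Proof.
case: p => c t /eqP; rewrite cards_eq0 /= => /eqP/setP w0; congr Pauli.
by apply/ffunP=> i; have := w0 i; rewrite !inE ffunE => /negbFE/eqP.
Qed.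

Lemma scalar_pauliM_phase c p :
  pauli_phase (scalar_pauli n c * p)%g = c + pauli_phase p.
Proof.
by rewrite -[RHS]addr0; congr (_ + _); apply: big1 => i _; rewrite ffunE.
Qed.

Lemma scalar_pauliM a b :
  (scalar_pauli n a * scalar_pauli n b)%g = scalar_pauli n (a + b).
Proof.
congr Pauli; first exact: (scalar_pauliM_phase a (scalar_pauli n b)).
by apply/ffunP=> i; rewrite !ffunE.
Qed.

Lemma weight_nontrivial_logical (S : {group pauli n}) p :
  p \in nontrivial_logical S -> (0 < weight p)%N.
Proof.
rewrite inE lt0n => /andP[_ /forallP/(_ (- pauli_phase p)) pS].
apply: contra pS => /eqP/weight_eq0 ->.
by rewrite scalar_pauliM addNr group1.
Qed.

End PauliGroupFacts.

Section Codespace.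
Variables (C : numClosedFieldType) (n : nat) (S : {group pauli n}).
Implicit Types psi phi : 'ket[C]_'I_n.

Lemma codespace_projl psi s : codespace S psi -> s \in S ->
  pauli_op C s *m proj_op psi = proj_op psi.
Proof. by move=> cpsi sS; rewrite mulmxA cpsi. Qed.

(** The adjoint of s psi = psi turns the bra into one ending in the adjoint of s, which unitarity
    cancels against s. *)
Lemma codespace_projr psi s : codespace S psi -> s \in S ->
  proj_op psi *m pauli_op C s = proj_op psi.
Proof.
move=> cpsi sS; rewrite /proj_op -mulmxA; congr (_ *m _).
by rewrite -{1}(cpsi s sS) trmx_mul map_mxM -mulmxA pauli_op_unitary mulmx1.
Qed.

Lemma tr_proj_op psi : unit_vector psi -> \tr (proj_op psi) = 1.
Proof. by move=> upsi; rewrite mxtrace_mulC upsi mxtrace1. Qed.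

Lemma expectation_noncentral psi p : codespace S psi -> p \notin 'C(S)%g ->
  \tr (pauli_op C p *m proj_op psi) = 0.
Proof.
move=> cpsi; apply: contraNeq => tr_neq0; apply/centP=> s sS.
apply: (@pauli_op_inj C); rewrite (pauli_op_phase C (pauli_stringC p s)).
set z := _ ^+ _; suff -> : z = 1 by rewrite scale1r.
(* Insert s to the left of the projector, commute it past p at the cost of [z], then cycle the trace
   so that the projector absorbs it on the right. *)
apply: (mulIf tr_neq0); rewrite mul1r -{2}(codespace_projl cpsi sS) mulmxA.
rewrite -pauli_opM (pauli_op_phase C (pauli_stringC p s)) -/z pauli_opM.
by rewrite -scalemxAl mxtraceZ -mulmxA [in RHS]mxtrace_mulC -mulmxA
  codespace_projr.
Qed.

Lemma expectation_stabilizer psi (p : pauli n) c :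
    codespace S psi -> unit_vector psi ->
  (scalar_pauli n c * p)%g \in S ->
  \tr (pauli_op C p *m proj_op psi) = 'i ^+ (- c)%R.
Proof.
move=> cpsi upsi pS; rewrite (@pauli_op_phase _ _ p (scalar_pauli n c * p)%g).
  rewrite -scalemxAl codespace_projl // mxtraceZ tr_proj_op // mulr1.
  by rewrite scalar_pauliM_phase opprD addrCA subrr addr0.
by apply/ffunP=> i; rewrite !ffunE.
Qed.

Lemma expectation_indep psi phi p :
    codespace S psi -> unit_vector psi -> codespace S phi -> unit_vector phi ->
    p \notin nontrivial_logical S ->
  \tr (pauli_op C p *m proj_op psi) = \tr (pauli_op C p *m proj_op phi).
Proof.
move=> cpsi upsi cphi uphi; have [pC|pC] := boolP (p \in 'C(S)%g); last first.
  by rewrite !expectation_noncentral.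
rewrite inE pC /= negb_forall => /existsP[c]; rewrite negbK => pS.
by rewrite !(expectation_stabilizer _ _ pS).
Qed.

Lemma trace_out_compl_indep (T : {set 'I_n}) psi phi :
    codespace S psi -> unit_vector psi -> codespace S phi -> unit_vector phi ->
    (forall p, p \in nontrivial_logical S -> (#|T| < weight p)%N) ->
  trace_out_compl T (proj_op psi) = trace_out_compl T (proj_op phi).
Proof.
move=> cpsi upsi cphi uphi distT; apply/matrixP=> i j.
rewrite !trace_out_complE tensor_op_pauli_expansion !mulmx_suml !raddf_sum /=.
apply: eq_bigr => t _; rewrite -!scalemxAl !mxtraceZ.
have [/subsetP supp|/subsetPn[q]] := boolP ([set q | t q != PI] \subset T).
  congr (_ * _); have -> : tensor_op (fun q => pauli1_mx C (t q)) =
    pauli_op C (Pauli 0 t) by rewrite /pauli_op expr0 scale1r.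
  apply: expectation_indep => //; apply/negP=> /distT.
  by rewrite ltnNge subset_leq_card //; apply/subsetP.
(* At [q] outside [T] the local factor is the identity, whose coefficient on a non-[PI] letter is
   zero. *)
rewrite inE => tq qT; rewrite (bigD1 q) //= /local_unit insubF ?(negPf qT) //.
by rewrite pauli1_coef1 // !mul0r.
Qed.

End Codespace.

Theorem mainTheorem5 (R : realType) (n k d : nat) (S : {group pauli n})
    (hS : stabilizer_code_dist k d S) (hk : (1 <= k)%N)
    (T : {set 'I_n}) (hT : (#|T| <= d - 1)%N)
    (psi phi : 'ket[R[i]]_'I_n)
    (psi_code : codespace S psi) (psi_unit : unit_vector psi)
    (phi_code : codespace S phi) (phi_unit : unit_vector phi) :
  trace_out_compl T (proj_op psi) = trace_out_compl T (proj_op phi).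
Proof.
(* The operator [p0] attaining the distance has positive weight, so [d] is positive and the
   truncated [d - 1] is a true predecessor. *)
case: hS => _ [[p0 /weight_nontrivial_logical + p0d] dmin]; rewrite p0d => d_gt0.
apply: trace_out_compl_indep psi_code psi_unit phi_code phi_unit _ => p /dmin.
by apply: leq_trans; rewrite -(subnK d_gt0) addn1 ltnS.
Qed.
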